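(* Let $n\geq4$. There exists a subset $\mathcal{T}^n$ of $G^n\bigl(\tfrac{1}{n+1}\bigr)$ with cardinality $$|\mathcal{T}^n|=4\sum_{s=0}^{\lfloor(n-2)/4\rfloor}\binom{n-1}{s}\leq2^{n-1}-4$$ and with the following property: for every $B\in\mathcal{S}^n$ with $m_B\leq\frac n2$, and for every subset $\mathcal{I}^{n-1}\bigl(\tfrac1n\bigr)$ of $G^{n-1}\bigl(\tfrac1n\bigr)$ of cardinality $2^{n-1}$ which deep illuminates every vector of $\mathbb{R}^{n-1}\setminus\{\vec0\}$, the body $B$ is illuminated by the set $$\bigl[\mathcal{I}^{n-1}\bigl(\tfrac1n\bigr)\times\{0\}\bigr]\cup\mathcal{T}^n.$$ It follows that, for any such body $B$, $\mathfrak{I}(B)\leq2^n-4$ (and, for sufficiently large $n$, $\mathfrak{I}(B)\leq2^{n-1}+\left(\frac{256}{27}\right)^{\frac n4+O(\log n)}$, with an absolute implied constant).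
   Context: A convex body in $\mathbb{R}^n$ is a compact convex set with non-empty interior. A convex body $B\subset\mathbb{R}^n$ is 1-symmetric if $(x_1,\ldots,x_n)\in B$ implies $(\epsilon_1x_{\sigma(1)},\ldots,\epsilon_nx_{\sigma(n)})\in B$ for all signs $\epsilon_i\in\{\pm1\}$ and all permutations $\sigma$ of $[n]=\{1,\ldots,n\}$. $\mathcal{S}^n$ denotes the class of 1-symmetric convex bodies $B\subset\mathbb{R}^n$ with $e_i\in\partial B$ for all standard basis vectors $e_i$. For $B\in\mathcal{S}^n$, $m_B=\max\{k\in[n]:e_1+e_2+\cdots+e_k\in B\}$. A direction is a non-zero vector; $d$ illuminates a boundary point $x$ of a convex body $K$ if there is $\varepsilon>0$ with $x+\varepsilon d\in\operatorname{int}K$; a set of directions illuminates $K$ if every boundary point of $K$ is illuminated by at least one of its elements; $\mathfrak{I}(K)$ is the smallest cardinality of a set of directions illuminating $K$. For $m\geq2$ and $\delta\in(0,1)$, $G^m(\delta)$ is the set of all $d\in\mathbb{R}^m$ for which there is $i\in[m]$ with $|d_i|=1$ and $|d_j|=\delta$ for all $j\neq i$. A set $\mathcal{I}\subset G^m(\delta)$ deep illuminates $x\in\mathbb{R}^m\setminus\{\vec0\}$ if there is $d\in\mathcal{I}$ such that $\operatorname{sign}(x_i)=-\operatorname{sign}(d_i)$ for every $i$ with $x_i\neq0$, and moreover $|d_j|=1$ for some $j$ with $x_j\neq0$. (For every $m\ge 2$ and $\delta\in(0,1)$ there exist subsets of $G^m(\delta)$ of cardinality $2^m$ which deep illuminate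 every non-zero vector of $\mathbb{R}^m$.) *)

(* Defs.v *)
From HB Require Import structures.
From mathcomp Require Import all_boot all_order all_algebra all_fingroup.
From mathcomp Require Import all_classical all_reals all_analysis.
Set Implicit Arguments.
Unset Strict Implicit.
Unset Printing Implicit Defensive.
Import Order.TTheory GRing.Theory Num.Theory.
Import numFieldNormedType.Exports.
Local Open Scope classical_set_scope.
Local Open Scope card_scope.
Local Open Scope ring_scope.

(* R^n is 'rV[R]_n; the library topologizes it by the sup norm, that is, with
   the usual topology. *)

Section Bodies.
Variables (R : realType) (n : nat).
Implicit Types (B K : set 'rV[R]_n) (D : set 'rV[R]_n).

Definition boundary K : set 'rV[R]_n := closure K `\` K°.

Definition convex_body K : Prop :=
  [/\ compact K, convex_set K & K° !=set0].

Definition one_symmetric B : Prop :=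
  forall (x : 'rV[R]_n) (eps : 'I_n -> bool) (s : 'S_n),
    B x -> B (\row_i ((-1) ^+ eps i * x ord0 (s i))).

Definition class_S B : Prop :=
  [/\ convex_body B, one_symmetric B
    & forall i : 'I_n, boundary B (delta_mx ord0 i)].

(* Coordinates are numbered from 0, so the i < k are the first k ones. *)
Definition sum_e (k : nat) : 'rV[R]_n :=
  \sum_(i < n | (i < k)%N) delta_mx ord0 i.

Definition m_ B : nat := (\max_(1 <= k < n.+1 | sum_e k \in B) k)%N.

Definition illuminates_point K (d x : 'rV[R]_n) : Prop :=
  exists2 e : R, 0 < e & K° (x + e *: d).

Definition illuminates D K : Prop :=
  (forall d, D d -> d != 0) /\
  (forall x, boundary K x -> exists2 d, D d & illuminates_point K d x).

(* The infimum is over a set of natural numbers, so it is a minimum as soon as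
   K is illuminated by a finite set of directions, and it is +oo otherwise. *)
Definition illumination_number K : \bar R :=
  ereal_inf [set k%:R%:E | k in
    [set k : nat | exists2 D, D #= `I_k & illuminates D K]].

End Bodies.

Section DeepIllumination.
Variables (R : realType) (m : nat).

Definition G_ (delta : R) : set 'rV[R]_m :=
  [set d | exists i : 'I_m,
     `|d ord0 i| = 1 /\ forall j, j != i -> `|d ord0 j| = delta].

Definition deep_illuminates (I : set 'rV[R]_m) (x : 'rV[R]_m) : Prop :=
  exists2 d, I d &
    (forall i, x ord0 i != 0 -> Num.sg (x ord0 i) = - Num.sg (d ord0 i)) /\
    (exists2 j, x ord0 j != 0 & `|d ord0 j| = 1).

End DeepIllumination.

Arguments G_ {R} m delta.

(* The point (x, 0) of R^n, for x in R^(n-1). *)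
Definition append0 (R : realType) (n : nat) (x : 'rV[R]_n.-1) : 'rV[R]_n :=
  \row_(i < n) oapp (x ord0) 0 (insub (i : nat) : option 'I_n.-1).

(* Main.v *)
Require Import Defs.
From HB Require Import structures.
From mathcomp Require Import all_boot all_order all_algebra all_fingroup.
From mathcomp Require Import all_classical all_reals all_analysis.
From mathcomp Require Import ring lra zify.
Set Implicit Arguments.
Unset Strict Implicit.
Unset Printing Implicit Defensive.
Import Order.TTheory GRing.Theory Num.Theory.
Import numFieldNormedType.Exports.
Local Open Scope classical_set_scope.
Local Open Scope card_scope.
Local Open Scope ring_scope.

(** Illuminating a boundary point x of B means leaving x towards the interior,
    and the symmetries of B make this a matter of comparing absolute values:
    a point whose coordinates are strictly smaller in absolute value than those
    of a point of B is interior (strictly_dominated_interior).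

    The main tool is illuminates_of_descent. Move from x in a direction d that
    decreases the coordinate |x_j| at unit speed and changes the other
    coordinates at speed less than delta, with (n - 1) delta < 1. Coordinates
    that decrease do no harm. A coordinate with |x_i| < |x_j| is allowed to
    increase: averaging x with its image under the transposition (i j)
    transfers mass from j to i and stays in B, and all these transfers together
    cost the coordinate j less than its unit decrease. So the moved point is
    dominated by a point of B. Finally a coordinate that d does not move causes
    no trouble if some point of B has a larger coordinate there, because the
    dominating point can be mixed with that one (mix_interior).

    Let x be in the boundary of B and let x_n be its last coordinate; |x_n| <= 1.
    - If |x_n| < 1, the first n - 1 coordinates are not all zero, for otherwise
      x = x_n e_n would be interior. A direction that deep illuminates them,
      extended by 0, works: among them, it decreases every nonzero
      coordinate and increases only zero ones, and e_n serves for the last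
      coordinate (illuminates_off_face).
    - If |x_n| = 1, use d with |d_n| = 1 and small other entries. Only the
      coordinates with |x_i| = 1 = |x_n| constrain the signs of d, since all the
      others can receive mass (illuminates_face). There are at most
      m_B - 1 <= (n - 2) / 2 of them besides x_n, so those equal to 1 or those
      equal to -1 number at most K = (n - 2) / 4 rounded down. Hence it is
      enough that T contains the sign patterns on the first n - 1 coordinates
      which have at most K minus signs or at most K plus signs, with both signs
      of d_n; this is 4 sum_(s <= K) C(n - 1, s) directions (card_skewed_patterns).

    The bound by 2^(n - 1) - 4 on that number is proved by induction on n in
    steps of 4 (binomial_head_lt), and the asymptotic bound by weighing the
    binomial expansion of (3 + 1)^(n - 1) (binomial_head_expn); the latter gives
    at most (256/27)^(n/4 + 1) directions, so the constant 1 can stand for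
    O(log n).

    For the illumination number one also needs a deep illuminating set of
    2^(n - 1) directions. It has one direction for each sign vector, whose unit
    entry is at the end of the initial constant run of signs (run_dir_deep). *)

(** * Convexity and small steps *)

Lemma convex_setD (R : realType) (V : lmodType R) (B : set V) (x y : V) (t : R) :
  convex_set B -> 0 <= t <= 1 -> B x -> B y -> B (t *: x + (1 - t) *: y).
Proof.
move=> cB /andP[t0 t1] Bx By; apply/set_mem.
exact: (cB x y (Itv01 t0 t1) (mem_set Bx) (mem_set By)).
Qed.

(** The sum is kept as a multiple of a point of B rather than normalized: the
    induction then goes through even when some partial sums of weights vanish,
    and the mass missing from 1 is left for the caller to spend. *)
Lemma convex_set_sum (R : realType) (V : lmodType R) (B : set V)
    (I : eqType) (r : seq I) (w : I -> R) (b : I -> V) :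
  convex_set B -> B !=set0 -> (forall i, 0 <= w i) -> (forall i, B (b i)) ->
  exists2 y, B y & \sum_(i <- r) w i *: b i = (\sum_(i <- r) w i) *: y.
Proof.
move=> cB [y0 By0] w0 Bb; elim: r => [|i r [y By IH]].
  by exists y0; rewrite // !big_nil scale0r.
rewrite !big_cons IH; set W := \sum_(_ <- r) _.
have W0 : 0 <= W by apply: sumr_ge0.
have [W00|Wn0] := eqVneq (w i + W) 0.
  have /eqP := W00; rewrite paddr_eq0// => /andP[/eqP-> /eqP->].
  by exists y; rewrite // addr0 !scale0r addr0.
have Wp : 0 < w i + W by rewrite lt_neqAle eq_sym Wn0 addr_ge0.
exists ((w i / (w i + W)) *: b i + (1 - w i / (w i + W)) *: y).
  apply: convex_setD => //; rewrite divr_ge0 ?(ltW Wp)//=.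
  by rewrite ler_pdivrMr// mul1r lerDl.
rewrite scalerDr !scalerA; congr (_ *: _ + _ *: _); first by field.
by field.
Qed.

Lemma exists_small_step (R : realType) (I : finType) (a b : I -> R) :
  (forall i, 0 < b i) -> exists2 e : R, 0 < e & forall i, e * a i < b i.
Proof.
move=> b0; suff : \forall e \near 0^'+, forall i, e * a i < b i.
  move=> H; near (0 : R)^'+ => e; exists e => //.
  by near: e.
apply: filter_forall => i.
have a1 : 0 < `|a i| + 1 by rewrite ltr_pwDr.
near=> e; apply: (@le_lt_trans _ _ (e * (`|a i| + 1))).
  by rewrite ler_pM2l// (le_trans (ler_norm _))// lerDl.
rewrite -ltr_pdivlMr//; near: e; apply: nbhs_right_lt.
by rewrite divr_gt0.
Unshelve. all: by end_near. Qed.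

(** Turns entries equal to delta into entries strictly below some admissible
    bound, as illuminates_of_descent asks. *)
Lemma exists_larger_bound (R : realType) m (delta : R) : m%:R * delta < 1 ->
  exists2 dl, delta < dl & m%:R * dl < 1.
Proof.
move=> md.
have [_|e e0 /(_ tt) He] :=
  @exists_small_step R unit (fun=> m%:R) (fun=> 1 - m%:R * delta).
  by rewrite subr_gt0.
by exists (delta + e); [rewrite ltrDl | rewrite mulrDr; lra].
Qed.

(** * Unconditional convex sets: domination and mass transfer *)

Section Geometry.
Context {R : realType} {n : nat}.
Implicit Types (B : set 'rV[R]_n) (x y z d : 'rV[R]_n).

Lemma flip_mem B x (i : 'I_n) : one_symmetric B -> B x ->
  B (\row_k (if k == i then - x ord0 i else x ord0 k)).
Proof.
move=> sB Bx; rewrite [X in B X](_ : _ =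
  \row_k ((-1) ^+ (k == i) * x ord0 ((1%g : 'S_n) k))); first exact: sB.
by apply/rowP => k; rewrite !mxE perm1; case: eqVneq => [->|_];
  rewrite ?mulN1r ?mul1r.
Qed.

Lemma swap_mem B x (i j : 'I_n) : one_symmetric B -> B x ->
  B (\row_k x ord0 (tperm i j k)).
Proof.
move=> sB Bx; rewrite [X in B X](_ : _ =
  \row_k ((-1) ^+ false * x ord0 (tperm i j k))).
  by have := sB x (fun=> false) (tperm i j) Bx.
by apply/rowP => k; rewrite !mxE mul1r.
Qed.

(** A coordinate y_i can be replaced by any c with |c| <= |y_i|: the result lies
    between y and its reflection in the i-th coordinate hyperplane. The
    coordinates are replaced one after the other. *)
Lemma dominated_mem B y z : convex_set B -> one_symmetric B -> B y ->
  (forall i, `|z ord0 i| <= `|y ord0 i|) -> B z.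
Proof.
move=> cB sB By zy.
suff H k : B (\row_i (if (i < k)%N then z ord0 i else y ord0 i)).
  rewrite [X in B X](_ : _ = \row_i (if (i < n)%N then z ord0 i else y ord0 i)) //.
  by apply/rowP => i; rewrite mxE ltn_ord.
elim: k => [|k IH]; first by rewrite [X in B X](_ : _ = y)//; apply/rowP => i; rewrite mxE.
have [kn|nk] := ltnP k n; last first.
  rewrite [X in B X](_ : _ = \row_i (if (i < k)%N then z ord0 i else y ord0 i)) //.
  apply/rowP => i; rewrite !mxE !(leq_trans (ltn_ord i))//.
  exact: leq_trans nk _.
set u := \row_i _ in IH; pose i0 := Ordinal kn.
have ui0 : u ord0 i0 = y ord0 i0 by rewrite mxE ltnn.
have := zy i0; set c := z ord0 i0 => zyi.
have [y0|yn0] := eqVneq (y ord0 i0) 0.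
  rewrite [X in B X](_ : _ = u)//; apply/rowP => i; rewrite !mxE ltnS leq_eqVlt.
  have [ik|//] := eqVneq (i : nat) k; rewrite ik ltnn /=.
  have -> : i = i0 by apply: val_inj.
  by rewrite y0; apply/eqP; rewrite -normr_le0 -/c (le_trans zyi) // y0 normr0.
have := flip_mem i0 sB IH; set v := \row_i _ => Bv.
have cy : `|c / y ord0 i0| <= 1 by rewrite normrM normfV ler_pdivrMr ?normr_gt0// mul1r.
(* The weights solve t y_i - (1 - t) y_i = c. *)
rewrite [X in B X](_ : _ = ((1 + c / y ord0 i0) / 2) *: u +
    (1 - (1 + c / y ord0 i0) / 2) *: v).
  apply: convex_setD => //; move: cy; rewrite ler_norml => /andP[? ?].
  by apply/andP; split; lra.
apply/rowP => i; rewrite [RHS]mxE [(_ *: u) _ _]mxE [(_ *: v) _ _]mxE [v _ _]mxE ui0.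
case: (eqVneq i i0) => [->|ii0].
  by rewrite ui0 mxE ltnS leqnn -/c; field.
rewrite -mulrDl addrCA subrr addr0 mul1r !mxE ltnS leq_eqVlt.
by rewrite (negbTE (_ : (i : nat) != k)).
Qed.

(** A sup-norm ball around z consists of points still dominated by y. *)
Lemma strictly_dominated_interior B y z : convex_set B -> one_symmetric B -> B y ->
  (forall i, `|z ord0 i| < `|y ord0 i|) -> B° z.
Proof.
move=> cB sB By zy.
have [e e0 He] := @exists_small_step _ _ (fun=> 1) (fun i => `|y ord0 i| - `|z ord0 i|)
  (fun i => ltac:(by rewrite subr_gt0)).
rewrite /interior; apply/nbhs_ballP; exists e => //= w [_ Hw].
apply: (dominated_mem cB sB By) => i.
have := Hw ord0 i; rewrite /ball /= => Hwi.
have := He i; rewrite mulr1 ltrBrDr => {}He; apply: ltW; apply: le_lt_trans He.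
rewrite (le_trans _ (lerD (ltW Hwi) (lexx _)))//.
by rewrite -(distrC (w _ _)) (le_trans _ (ler_normD _ _))// subrK.
Qed.

(** With weight h close to 0, the mixture (1 - h)|y| + h|p| keeps the strict
    inequalities given by y and gains one wherever p is larger than z. *)
Lemma mix_interior B y p z : convex_set B -> one_symmetric B -> B y -> B p ->
  (forall i, `|z ord0 i| < `|y ord0 i| \/
     `|z ord0 i| <= `|y ord0 i| /\ `|z ord0 i| < `|p ord0 i|) -> B° z.
Proof.
move=> cB sB By Bp zyp.
have absB (x : 'rV[R]_n) : B x -> B (\row_i `|x ord0 i|).
  by move=> Bx; apply: (dominated_mem cB sB Bx) => i; rewrite mxE normr_id.
pose b i := if `|z ord0 i| < `|y ord0 i| then `|y ord0 i| - `|z ord0 i| else 1.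
have [i|e e0 He] := @exists_small_step _ _ (fun i => `|y ord0 i|) b.
  by rewrite /b; case: ifP => // ?; rewrite subr_gt0.
(* Any cap below 1 keeps the weight of y positive. *)
pose h := Num.min e 2^-1.
have h0 : 0 < h by rewrite lt_min e0/= invr_gt0.
have h1 : h < 1 by rewrite gt_min; apply/orP; right; lra.
apply: (@strictly_dominated_interior B
  (h *: (\row_i `|p ord0 i|) + (1 - h) *: (\row_i `|y ord0 i|))) => //.
  by apply: convex_setD; rewrite ?ltW//=; exact: absB.
move=> i; rewrite !mxE; apply: lt_le_trans (ler_norm _).
have p0 := normr_ge0 (p ord0 i); have y0 := normr_ge0 (y ord0 i).
case: (zyp i) => [zy|[zy zp]]; last by nra.
have he : h * `|y ord0 i| <= e * `|y ord0 i| by rewrite ler_wpM2r// ge_min lexx.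
by have := He i; rewrite /b zy; nra.
Qed.

(** The average of x and its images under the transpositions (j i), with weight
    t_i for the latter: coordinate i moves towards x_j by the fraction t_i of the
    gap, and coordinate j pays for all of these moves. *)
Lemma transfer_mem B x (j : 'I_n) (t : 'I_n -> R) :
  convex_set B -> one_symmetric B -> B x ->
  (forall i, 0 <= t i) -> \sum_i t i <= 1 ->
  B (\row_i (if i == j then x ord0 j - \sum_k t k * (x ord0 j - x ord0 k)
             else x ord0 i + t i * (x ord0 j - x ord0 i))).
Proof.
move=> cB sB Bx t0 t1.
have [|u Bu Eu] := convex_set_sum (index_enum 'I_n) cB _ t0 (fun i => swap_mem j i sB Bx).
  by exists x.
have s0 : 0 <= \sum_i t i by apply: sumr_ge0.
rewrite [X in B X](_ : _ = (\sum_i t i) *: u + (1 - \sum_i t i) *: x).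
  by apply: convex_setD => //; rewrite s0.
rewrite -Eu; apply/rowP => i; rewrite !mxE summxE; under [in RHS]eq_bigr do rewrite !mxE.
case: eqVneq => [->|ij].
  under [in RHS]eq_bigr do rewrite tpermL.
  rewrite [X in _ - X](_ : _ = (\sum_k t k) * x ord0 j - \sum_k t k * x ord0 k).
    by ring.
  by rewrite mulr_suml -sumrB; apply: eq_bigr => k _; rewrite mulrBr.
rewrite (bigD1 i)//= tpermR [X in _ + X + _](_ : _ = (\sum_(k | k != i) t k) * x ord0 i).
  by rewrite [\sum_(k < n) t k](bigD1 i)//=; ring.
rewrite mulr_suml; apply: eq_bigr => k ki; rewrite tpermD// eq_sym//.
Qed.

Lemma norm_step (a c e : R) : a * c < 0 -> 0 <= e -> e * `|c| <= `|a| ->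
  `|a + e * c| = `|a| - e * `|c|.
Proof.
move=> ac e0; have [a0|a0|a0] := ltgtP a 0; last by nra.
  have c0 : 0 < c by nra.
  rewrite (ltr0_norm a0) (gtr0_norm c0) => h; rewrite ler0_norm; first by ring.
  by lra.
have c0 : c < 0 by nra.
rewrite (gtr0_norm a0) (ltr0_norm c0) => h; rewrite ger0_norm; first by ring.
by lra.
Qed.

(** The weights of the transfer are chosen so that every coordinate smaller than
    |x_j| grows by e * delta, more than d can make it grow; coordinate j then
    loses at most (n - 1) e delta < e, less than d takes from it. *)
Lemma illuminates_of_descent B x p d (j : 'I_n) (delta : R) :
  convex_set B -> one_symmetric B -> B x -> B p ->
  0 <= delta -> n.-1%:R * delta < 1 ->
  `|d ord0 j| = 1 -> x ord0 j * d ord0 j < 0 ->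
  (forall i, i != j -> `|d ord0 i| < delta) ->
  (forall i, i != j -> [\/ x ord0 i * d ord0 i < 0, `|x ord0 i| < `|x ord0 j|
     | d ord0 i = 0 /\ `|x ord0 i| < `|p ord0 i|]) ->
  illuminates_point B d x.
Proof.
move=> cB sB Bx Bp de0 nde dj xdj dlt H.
pose A i := `|x ord0 i| < `|x ord0 j|.
(* The true indices ask that no decreasing coordinate crosses 0, the false ones
   that each transfer weight is below 1/n, so that the weights sum to at
   most 1. *)
pose a (q : bool * 'I_n) := if q.1 then `|d ord0 q.2| else
  n%:R * (delta / (`|x ord0 j| - `|x ord0 q.2|)).
pose b (q : bool * 'I_n) := if q.1 && (x ord0 q.2 != 0) then `|x ord0 q.2| else 1.
have [q|e e0 He] := @exists_small_step _ _ a b.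
  by rewrite /b; case: ifP => // /andP[_]; rewrite normr_gt0.
exists e => //.
have n0 : (0 < n)%N by apply: leq_ltn_trans (ltn_ord j).
pose t i := if A i then e * (delta / (`|x ord0 j| - `|x ord0 i|)) else 0.
have t0 i : 0 <= t i.
  by rewrite /t /A; case: ifP => // ?; rewrite mulr_ge0 ?(ltW e0)// divr_ge0// subr_ge0 ltW.
have tn i : t i <= n%:R^-1.
  have := He (false, i); rewrite /a /b /t /=; case: ifP => [_|_ _]; last by rewrite invr_ge0.
  move=> h; rewrite -[leRHS]mul1r ler_pdivlMr ?ltr0n//; apply: ltW.
  by rewrite mulrC mulrCA.
have st : \sum_i t i <= 1.
  apply: (@le_trans _ _ (\sum_(i < n) n%:R^-1)); first exact: ler_sum.
  by rewrite sumr_const card_ord -[_ *+ n]mulr_natr mulVf// pnatr_eq0 -lt0n.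
have tA i : t i * (`|x ord0 j| - `|x ord0 i|) = if A i then e * delta else 0.
  rewrite /t /A; case: ifP => [h|_]; last by rewrite mul0r.
  by rewrite -mulrA divfK// subr_eq0 gt_eqF.
pose ax := \row_i `|x ord0 i|.
have Bax : B ax by apply: (dominated_mem cB sB Bx) => i; rewrite mxE normr_id.
have := transfer_mem j cB sB Bax t0 st; set y := \row_i _ => By.
have xd i : x ord0 i * d ord0 i < 0 ->
    `|x ord0 i + e * d ord0 i| = `|x ord0 i| - e * `|d ord0 i|.
  move=> xdi; apply: norm_step => //; first exact: ltW.
  have := He (true, i); rewrite /a /b /= ifT; first exact: ltW.
  by apply: contraTneq xdi => ->; rewrite mul0r ltxx.
apply: (mix_interior cB sB By Bp) => i.
rewrite [(x + _) _ _]mxE [(e *: d) _ _]mxE.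
have [->|ij] := eqVneq i j.
  left; rewrite xd// dj mulr1; apply: lt_le_trans (ler_norm _).
  rewrite mxE eqxx !mxE ltrD2l ltrN2.
  under eq_bigr do rewrite mxE tA.
  apply: (@le_lt_trans _ _ (\sum_(k < n | k != j) e * delta)).
    rewrite (bigD1 j)//= {1}/A ltxx add0r; apply: ler_sum => k _.
    by case: ifP => // _; rewrite mulr_ge0// ltW.
  rewrite sumr_const cardC1 card_ord -mulrnAr -[X in e * X]mulr_natl.
  by rewrite gtr_pMr.
have yi : y ord0 i = `|x ord0 i| + (if A i then e * delta else 0).
  by rewrite !mxE (negbTE ij) tA.
case: (boolP (A i)) yi => [Ai|nAi] yi.
  left; apply: lt_le_trans (ler_norm _); rewrite yi.
  rewrite (le_lt_trans (ler_normD _ _))// ltrD2l normrM (gtr0_norm e0) ltr_pM2l//.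
  exact: dlt.
case: (H i ij) => [xdi|Ai|[di0 xp]]; first 1 last.
- by rewrite /A Ai in nAi.
- by right; rewrite di0 mulr0 addr0 yi addr0 normr_id.
left; rewrite yi addr0 normr_id xd// ltrBlDr ltrDl mulr_gt0// normr_gt0.
by apply: contraTneq xdi => ->; rewrite mulr0 ltxx.
Qed.

End Geometry.

(** * Bodies of the class S *)

Section SymmetricBodies.
Context {R : realType} {n : nat}.
Implicit Types (B : set 'rV[R]_n) (x : 'rV[R]_n).

Lemma boundary_class_S_sub B : class_S B -> boundary B `<=` B.
Proof.
move=> [[cB _ _] _ _] x [+ _].
by rewrite -(closure_id B).1//; apply: compact_closed => //; exact: norm_hausdorff.
Qed.

Lemma basis_mem B (i : 'I_n) : class_S B -> B (delta_mx ord0 i).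
Proof. by move=> SB; apply: boundary_class_S_sub => //; case: SB. Qed.

(** Take the barycentre of the basis vectors: such a point makes vanishing
    coordinates harmless in mix_interior. *)
Lemma positive_mem B : class_S B -> exists2 p, B p & forall i, 0 < p ord0 i.
Proof.
move=> SB; have [[_ cB [x0 Bx0]] sB _] := SB.
have [|i|p Bp Ep] := @convex_set_sum R _ B _ (index_enum 'I_n) (fun=> n%:R^-1)
    (fun i => delta_mx ord0 i) cB _ _ (fun i => basis_mem i SB).
- by exists x0; apply: interior_subset.
- by rewrite invr_ge0.
exists p => // i; have n0 : (0 < n)%N by apply: leq_ltn_trans (ltn_ord i).
have s1 : \sum_(k < n) n%:R^-1 = 1 :> R.
  by rewrite sumr_const card_ord -[LHS]mulr_natr mulVf// pnatr_eq0 -lt0n.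
rewrite -[p]scale1r -s1 -Ep; rewrite summxE (bigD1 i)//= big1 => [|k ki].
  by rewrite !mxE !eqxx mulr1 addr0 invr_gt0 ltr0n.
by rewrite !mxE eq_sym (negbTE ki) andbF mulr0.
Qed.

(** If |x_i| > 1, then x_i e_i is in B by domination, and mixed with a positive
    point it strictly dominates e_i, which is on the boundary. *)
Lemma coord_le1 B x (i : 'I_n) : class_S B -> B x -> `|x ord0 i| <= 1.
Proof.
move=> SB Bx; have [[_ cB _] sB /(_ i)[_ ei]] := SB.
rewrite leNgt; apply/negP => x1; apply: ei.
have [p Bp p0] := positive_mem SB.
apply: (@mix_interior _ _ B (x ord0 i *: delta_mx ord0 i) p) => //.
  apply: (dominated_mem cB sB Bx) => k; rewrite !mxE eqxx /=.
  by case: eqVneq => [->|_]; rewrite ?mulr1// mulr0 normr0.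
move=> k; rewrite !mxE eqxx /=; case: eqVneq => [_|_].
  by left; rewrite mulr1 normr1.
by right; rewrite mulr0 normr0 lexx normr_gt0 gt_eqF.
Qed.

Lemma exists_perm_initial (A : {set 'I_n}) :
  exists s : 'S_n, forall i : 'I_n, (i < #|A|)%N -> s i \in A.
Proof.
pose l := enum A ++ enum (~: A).
have ul : uniq l.
  rewrite cat_uniq !enum_uniq andbT /=; apply/hasPn => k.
  by rewrite /= !mem_enum inE.
have sl : size l = n by rewrite size_cat -!cardE cardsC card_ord.
have finj : injective (fun i : 'I_n => nth i l i).
  move=> i j; rewrite (set_nth_default i j) ?sl// => /eqP.
  by rewrite nth_uniq ?sl// => /eqP/val_inj.
exists (perm finj) => i iA; rewrite permE nth_cat -cardE iA.
by rewrite -mem_enum mem_nth// -cardE.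
Qed.

(** Move the coordinates in A to the front; the result dominates the sum of the
    first #|A| basis vectors. *)
Lemma card_extremal_coords_le B x (A : {set 'I_n}) : class_S B -> B x ->
  (forall i, i \in A -> `|x ord0 i| = 1) -> (#|A| <= m_ B)%N.
Proof.
move=> SB Bx Ax; have [[_ cB _] sB _] := SB.
have [->//|A0] := posnP #|A|.
rewrite /m_; apply: leq_bigmax_seq.
  by rewrite mem_index_iota A0 ltnS (leq_trans (max_card _))// card_ord.
apply/mem_set; have [s sA] := exists_perm_initial A.
apply: (dominated_mem cB sB (sB x (fun=> false) s Bx)) => i.
rewrite !mxE mul1r summxE; case: (ltnP i #|A|) => iA.
  rewrite Ax ?sA// (bigD1 i)//= big1 => [|k /andP[_ ki]].
    by rewrite mxE !eqxx addr0 normr1.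
  by rewrite mxE eq_sym (negbTE ki) andbF.
rewrite big1 ?normr0// => k kA; rewrite mxE eqxx /=; case: eqVneq => // ik.
by rewrite -ik ltnNge iA in kA.
Qed.

End SymmetricBodies.

(** * The directions for the points with last coordinate 1 or -1 *)

Section Directions.
Context {R : realType} {m : nat}.

Lemma append0_last (d : 'rV[R]_m) : append0 (n := m.+1) d ord0 ord_max = 0.
Proof. by rewrite mxE insubF//= ltnn. Qed.

Lemma append0_lift (d : 'rV[R]_m) (k : 'I_m) :
  append0 (n := m.+1) d ord0 (lift ord_max k) = d ord0 k.
Proof.
rewrite mxE; have -> : (lift ord_max k : nat) = k by rewrite lift_max.
by rewrite (valK k).
Qed.

(** Both s and A record the places of the minus signs. *)
Definition peaked_dir (delta : R) (s : bool) (A : {set 'I_m}) : 'rV[R]_m.+1 :=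
  \row_i (if unlift ord_max i is Some k then (-1) ^+ (k \in A) * delta
          else (-1) ^+ s).

Lemma peaked_dir_last delta s A : peaked_dir delta s A ord0 ord_max = (-1) ^+ s.
Proof. by rewrite mxE unlift_none. Qed.

Lemma peaked_dir_lift delta s A k :
  peaked_dir delta s A ord0 (lift ord_max k) = (-1) ^+ (k \in A) * delta.
Proof. by rewrite mxE liftK. Qed.

Lemma peaked_dir_inj delta : 0 < delta -> injective (uncurry (peaked_dir delta)).
Proof.
move=> d0 [s A] [t C] /= /rowP E; congr pair.
    by have := E ord_max; rewrite !peaked_dir_last => /signr_inj.
apply/setP => k; have := E (lift ord_max k); rewrite !peaked_dir_lift.
by move/(mulIf (lt0r_neq0 d0))/signr_inj.
Qed.

Lemma peaked_dir_G delta s A : 0 < delta -> G_ m.+1 delta (peaked_dir delta s A).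
Proof.
move=> d0; exists ord_max; rewrite peaked_dir_last normr_sign; split=> // j.
case: (unliftP ord_max j) => [k ->|->]; last by rewrite eqxx.
by rewrite peaked_dir_lift normrM normr_sign mul1r gtr0_norm.
Qed.

End Directions.

(** * Illumination of the boundary *)

Section Illumination.
Context {R : realType} {m : nat}.
Implicit Types (B : set 'rV[R]_m.+1) (x d : 'rV[R]_m.+1).

(** Only the coordinates of absolute value 1 constrain the signs: since the last
    coordinate has absolute value 1 too, every other one is smaller and can
    receive mass from it. *)
Lemma illuminates_face B x (delta : R) (s : bool) (A : {set 'I_m}) : class_S B -> B x ->
  0 < delta -> m%:R * delta < 1 -> x ord0 ord_max = - (-1) ^+ s ->
  (forall k, `|x ord0 (lift ord_max k)| = 1 ->
     x ord0 (lift ord_max k) = - (-1) ^+ (k \in A)) ->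
  illuminates_point B (peaked_dir delta s A) x.
Proof.
move=> SB Bx d0 md xn xA; have [[_ cB _] sB _] := SB.
have [dl dl1 dl2] : exists2 dl, delta < dl & m%:R * dl < 1
  by exact: exists_larger_bound.
apply: (@illuminates_of_descent _ _ B x x _ ord_max dl) => //.
- by rewrite ltW// (lt_trans d0).
- by rewrite peaked_dir_last normr_sign.
- by rewrite peaked_dir_last xn mulNr -expr2 sqrr_sign oppr_lt0 ltr01.
- move=> i; case: (unliftP ord_max i) => [k ->|->]; last by rewrite eqxx.
  by rewrite peaked_dir_lift normrM normr_sign mul1r gtr0_norm.
move=> i; case: (unliftP ord_max i) => [k ->|->]; last by rewrite eqxx.
move=> _; have := coord_le1 (lift ord_max k) SB Bx; rewrite le_eqVlt => /orP[/eqP x1|x1].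
  apply: Or31; rewrite peaked_dir_lift xA// mulrA mulNr -expr2 sqrr_sign.
  by rewrite mulN1r oppr_lt0.
by apply: Or32; rewrite xn normrN normr_sign.
Qed.

(** The last coordinate is not moved; as |x_n| < 1, the point e_n of B is larger
    there. The descending coordinate is the one where deep illumination provides
    an entry of absolute value 1. *)
Lemma illuminates_off_face B x (I : set 'rV[R]_m) (delta : R) : class_S B ->
  boundary B x -> `|x ord0 ord_max| < 1 -> 0 < delta -> m%:R * delta < 1 ->
  I `<=` G_ m delta ->
  (forall u : 'rV[R]_m, u != 0 -> deep_illuminates I u) ->
  exists2 d, I d & illuminates_point B (append0 (n := m.+1) d) x.
Proof.
move=> SB bx xn d0 md IG Ideep; have [[_ cB _] sB _] := SB.
have Bx := boundary_class_S_sub SB bx.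
have [dl dl1 dl2] : exists2 dl, delta < dl & m%:R * dl < 1
  by exact: exists_larger_bound.
pose u : 'rV[R]_m := \row_k x ord0 (lift ord_max k).
have Ben := basis_mem ord_max SB.
have [u0|un0] := eqVneq u 0.
  case: bx => _ []; have [p Bp p0] := positive_mem SB.
  apply: (mix_interior cB sB Ben Bp) => i; rewrite mxE eqxx /=.
  case: (unliftP ord_max i) => [k ->|->]; last by rewrite eqxx normr1; left.
  have -> : x ord0 (lift ord_max k) = 0.
    by have /rowP/(_ k) := u0; rewrite !mxE.
  rewrite eq_sym (negbTE (neq_lift _ _)) normr0; right; split => //.
  by rewrite normr_gt0 gt_eqF.
have [d Id [dsg [j uj dj]]] := Ideep u un0; exists d => //.
have opp k : u ord0 k != 0 -> u ord0 k * d ord0 k < 0.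
  move=> uk; have /= := dsg k uk; rewrite -sgr_lt0 sgrM => ->.
  have dk : d ord0 k != 0.
    apply/eqP => dk0; move/eqP: (dsg k uk).
    by rewrite dk0 sgr0 oppr0 sgr_eq0 (negbTE uk).
  by rewrite mulNr -expr2 sqr_sg dk oppr_lt0 ltr01.
have dlt k : k != j -> `|d ord0 k| < dl.
  move=> kj; have [i [di dother]] := IG d Id.
  have [ij|ij] := eqVneq i j; first by rewrite dother// ij.
  have d1 : delta = 1 by rewrite -dj dother// eq_sym.
  move: md; rewrite d1 mulr1 ltNge ler1n.
  by rewrite (leq_ltn_trans (leq0n j) (ltn_ord j)).
apply: (@illuminates_of_descent _ _ B x (delta_mx ord0 ord_max) _ (lift ord_max j) dl) => //.
- by rewrite ltW// (lt_trans d0).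
- by rewrite append0_lift.
- by have := opp j uj; rewrite append0_lift mxE.
- move=> i; case: (unliftP ord_max i) => [k ->|->].
    by rewrite append0_lift => kj; apply: dlt; apply: contra_neq kj => ->.
  by rewrite append0_last normr0 (lt_trans d0).
move=> i; case: (unliftP ord_max i) => [k ->|->] _; last first.
  by apply: Or33; rewrite append0_last mxE !eqxx normr1.
have [uk|uk] := eqVneq (u ord0 k) 0.
  apply: Or32; move: uk uj; rewrite !mxE => -> uj.
  by rewrite normr0 normr_gt0.
by apply: Or31; have := opp k uk; rewrite append0_lift mxE.
Qed.

Definition skewed_patterns (K : nat) : {set bool * {set 'I_m}} :=
  [set q : bool * {set 'I_m} | (#|q.2| <= K)%N || (#|~: q.2| <= K)%N]%SET.

(** At most 2K + 1 coordinates besides the last one have absolute value 1, so at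
    most K of them are positive or at most K are negative. Put the opposing sign
    at the places of the rarer kind and the other sign everywhere else. *)
Lemma illuminates_all B (I : set 'rV[R]_m) (delta delta' : R) K : class_S B ->
  (m_ B <= K.*2.+2)%N ->
  0 < delta -> m%:R * delta < 1 -> 0 < delta' -> m%:R * delta' < 1 ->
  I `<=` G_ m delta ->
  (forall u : 'rV[R]_m, u != 0 -> deep_illuminates I u) ->
  illuminates ([set append0 (n := m.+1) d | d in I] `|`
    (uncurry (peaked_dir delta')) @` [set` skewed_patterns K]) B.
Proof.
move=> SB mB d0 md d'0 md' IG Ideep; split=> [d|x bx].
  case=> [[c Ic <-]|[[s A] _ <-]].
    have [i [ci _]] := IG c Ic; apply/eqP => /rowP/(_ (lift ord_max i)).
    rewrite append0_lift mxE => ci0; move/eqP: ci.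
    by rewrite ci0 normr0 eq_sym oner_eq0.
  apply/eqP => /rowP/(_ ord_max) /eqP.
  by rewrite /= peaked_dir_last mxE signr_eq0.
have Bx := boundary_class_S_sub SB bx.
have := coord_le1 ord_max SB Bx; rewrite le_eqVlt => /orP[/eqP xn|xn]; last first.
  have [d Id Hd] := illuminates_off_face SB bx xn d0 md IG Ideep.
  by exists (append0 (n := m.+1) d) => //; left; exists d.
pose P := [set k : 'I_m | x ord0 (lift ord_max k) == 1]%SET.
pose M := [set k : 'I_m | x ord0 (lift ord_max k) == -1]%SET.
have PM : [disjoint P & M]%B.
  rewrite finset.disjoints_subset; apply/fintype.subsetP => k; rewrite !inE => /eqP ->.
  by apply/eqP => h; have : (0 : R) < 2 by []; lra.
have card_PM : (#|P| + #|M| <= K.*2.+1)%N.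
  rewrite -ltnS; apply: leq_trans mB.
  have -> : (#|P| + #|M|).+1 = #|ord_max |: (lift ord_max @: (P :|: M))|.
    rewrite cardsU1 card_imset; last exact: lift_inj.
    rewrite cardsU (disjoint_setI0 PM) cards0 subn0 -add1n; congr (_ + _)%N.
    rewrite (_ : _ \in _ = false)//; apply/imsetP => -[k _ /eqP].
    by rewrite (negbTE (neq_lift _ _)).
  apply: card_extremal_coords_le SB Bx _ => i; rewrite !inE => /orP[/eqP ->//|].
  by case/imsetP => k; rewrite !inE => /orP[]/eqP xk ->; rewrite xk ?normrN normr1.
have [A AK xA] : exists2 A : {set 'I_m}, (#|A| <= K)%N || (#|~: A| <= K)%N &
    forall k, `|x ord0 (lift ord_max k)| = 1 ->
      x ord0 (lift ord_max k) = - (-1) ^+ (k \in A).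
  have x1 k : `|x ord0 (lift ord_max k)| = 1 -> (k \in P) != (k \in M).
    move/eqP; rewrite eqr_norml => /andP[/orP[kP|kM] _].
      have {}kP : k \in P by rewrite inE.
      by rewrite kP (disjointFr PM kP).
    have {}kM : k \in M by rewrite inE.
    by rewrite kM (disjointFl PM kM).
  have xE k : k \in P -> x ord0 (lift ord_max k) = 1 by rewrite inE => /eqP.
  have xE' k : k \in M -> x ord0 (lift ord_max k) = -1 by rewrite inE => /eqP.
  have [PK|PK] := leqP #|P| K.
    exists P; rewrite ?PK// => k /x1.
    case: (boolP (k \in P)) => [/xE ->|_]; first by rewrite opprK.
    by case: (boolP (k \in M)) => // /xE' ->.
  exists (~: M).
    rewrite finset.setCK; apply/orP; right; rewrite -(leq_add2l K.+1).
    by rewrite [leqRHS]addSn addnn (leq_trans _ card_PM)// leq_add2r.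
  move=> k /x1; rewrite finset.in_setC; case: (boolP (k \in M)) => [/xE' ->//|_].
  by case: (boolP (k \in P)) => // /xE -> _; rewrite opprK.
exists (peaked_dir delta' (x ord0 ord_max == 1) A).
  by right; exists (x ord0 ord_max == 1, A) => //=; rewrite inE.
apply: illuminates_face => //.
move/eqP: xn; rewrite eqr_norml => /andP[/orP[] + _].
  by move=> /eqP ->; rewrite eqxx opprK.
by move=> /eqP ->; rewrite (_ : (-1 == 1 :> R) = false)//; apply/eqP => h; lra.
Qed.

End Illumination.

(** * A deep illuminating set *)

Section DeepSet.
Context {R : realType} {p : nat}.
Local Notation m := p.+1.

(** The last index of the longest initial segment on which membership in A, seen
    as a sign vector, is constant. *)
Definition run_end (A : {set 'I_m}) : 'I_m :=
  [arg max_(i > ord0 |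
     [forall k : 'I_m, (k <= i)%N ==> ((k \in A) == (ord0 \in A))]) i].

Lemma run_endP (A : {set 'I_m}) : (run_end A \in A) = (ord0 \in A) /\
  forall i : 'I_m, (forall k : 'I_m, (k <= i)%N -> (k \in A) = (ord0 \in A)) ->
    (i <= run_end A)%N.
Proof.
rewrite /run_end; case: arg_maxnP => [|q /forallP qA qmax].
  apply/forallP => k; apply/implyP; rewrite leqn0 => /eqP k0.
  by rewrite (_ : k = ord0)//; apply: val_inj.
split=> [|i iA]; first by have := qA q; rewrite leqnn => /eqP.
by apply: qmax; apply/forallP => k; apply/implyP => /iA ->.
Qed.

Definition run_dir (delta : R) (A : {set 'I_m}) : 'rV[R]_m :=
  \row_i ((-1) ^+ (i \in A) * (if i == run_end A then 1 else delta)).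

Lemma run_dir_sg delta A i : 0 < delta ->
  Num.sg (run_dir delta A ord0 i) = (-1) ^+ (i \in A).
Proof.
move=> d0; rewrite mxE sgrM [X in _ * X]gtr0_sg; last by case: ifP.
by rewrite mulr1; case: (i \in A); rewrite ?expr1 ?expr0 ?sgrN1 ?sgr1.
Qed.

Lemma run_dir_inj delta : 0 < delta -> injective (run_dir delta).
Proof.
move=> d0 A C AC; apply/setP => i; apply: (@signr_inj R).
by rewrite -(run_dir_sg A i d0) -(run_dir_sg C i d0) AC.
Qed.

Lemma run_dir_G delta A : 0 < delta -> G_ m delta (run_dir delta A).
Proof.
move=> d0; exists (run_end A); split=> [|j ji].
  by rewrite mxE eqxx mulr1 normr_sign.
by rewrite mxE (negbTE ji) normrM normr_sign mul1r gtr0_norm.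
Qed.

(** Let q be the first nonzero coordinate of x. The signs are forced where x is
    nonzero; elsewhere put the sign forced at q before q, and the other sign after
    q. The initial run of constant sign reaches q, and past q it only goes through
    nonzero coordinates of x, so it ends at a nonzero coordinate. *)
Lemma run_dir_deep delta (x : 'rV[R]_m) : 0 < delta -> x != 0 ->
  deep_illuminates (range (run_dir delta)) x.
Proof.
move=> d0 x0.
have [i0 xi0] : exists i, x ord0 i != 0.
  apply/existsP; apply: contraNT x0; rewrite negb_exists => /forallP xz.
  by apply/eqP/rowP => i; rewrite mxE; apply/eqP/negPn/xz.
case: (@arg_minnP _ i0 (fun i => x ord0 i != 0) (fun i => i : nat)) => // q xq qmin.
pose A : {set 'I_m} := [set i | if x ord0 i != 0 then 0 < x ord0 i
  else (i <= q)%N == (0 < x ord0 q)]%SET.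
have Aq (k : 'I_m) : (k <= q)%N -> (k \in A) = (0 < x ord0 q).
  move=> kq; rewrite inE kq; case: ifPn => // xk.
  by rewrite (_ : k = q)//; apply/val_inj/eqP; rewrite eqn_leq kq qmin.
exists (run_dir delta A); first by exists A.
split=> [i xi|].
  rewrite run_dir_sg// inE xi; move: xi; rewrite neq_lt => /orP[xi|xi].
    by rewrite (ltr0_sg xi) ltNge (ltW xi) expr0.
  by rewrite (gtr0_sg xi) xi expr1 opprK.
have [rA rmax] := run_endP A.
have qr : (q <= run_end A)%N.
  by apply: rmax => k kq; rewrite !Aq.
exists (run_end A); last by rewrite mxE eqxx mulr1 normr_sign.
apply/negP => /eqP xr.
have rq : (run_end A <= q)%N = false.
  apply/negbTE; rewrite -ltnNge ltn_neqAle qr andbT.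
  by apply: contraNneq xq => /val_inj ->; rewrite xr.
move: rA; rewrite (Aq ord0)// inE xr eqxx /= rq.
by case: (_ < _).
Qed.

End DeepSet.

(** * Counting *)

Lemma image_finset_card (F : finType) (T : Type) (f : F -> T) (A : {set F}) :
  injective f -> f @` [set` A] #= `I_#|A|.
Proof.
move=> finj.
have -> : f @` [set` A] = (fun i : 'I_#|A| => f (enum_val i)) @` setT.
  apply/seteqP; split=> [_ [a aA <-]|_ [i _ <-]]; last first.
    by exists (enum_val i) => //; exact: enum_valP.
  by exists (enum_rank_in aA a) => //; rewrite enum_rankK_in.
rewrite (card_eqr card_II); apply: inj_card_eq => i j _ _ /finj.
exact: enum_val_inj.
Qed.

Lemma illumination_number_leU (R : realType) n (B D1 D2 : set 'rV[R]_n) a b :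
  D1 #= `I_a -> D2 #= `I_b -> illuminates (D1 `|` D2) B ->
  (illumination_number B <= (a + b)%:R%:E)%E.
Proof.
move=> D1a D2b DB.
have f1 : finite_set D1 by apply/finite_setP; exists a.
have f2 : finite_set D2 by apply/finite_setP; exists b.
have /finite_setP[k Dk] : finite_set (D1 `|` D2) by rewrite finite_setU.
apply: (@le_trans _ _ k%:R%:E).
  by apply: ereal_inf_lbound; exists k => //; exists (D1 `|` D2).
rewrite lee_fin ler_nat -(card_fset_set Dk) fset_setU//.
by rewrite finmap.cardfsU (card_fset_set D1a) (card_fset_set D2b) leq_subr.
Qed.

Local Open Scope nat_scope.

(** The bound is exclusive, which makes Pascal's rule uniform in k. *)
Definition binomial_head (m k : nat) := \sum_(0 <= s < k) 'C(m, s).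

Lemma binomial_headS m k : binomial_head m k.+1 = binomial_head m k + 'C(m, k).
Proof. exact: big_nat_recr. Qed.

Lemma binomial_head_pascal m k :
  binomial_head m.+1 k.+1 = binomial_head m k.+1 + binomial_head m k.
Proof.
rewrite /binomial_head big_nat_recl// [in RHS]big_nat_recl// bin0 -addnA.
by rewrite -big_split/= bin0.
Qed.

Lemma binomial_head_double m k : binomial_head m.+1 k <= 2 * binomial_head m k.
Proof.
case: k => [|k]; first by rewrite /binomial_head big_nil.
by rewrite binomial_head_pascal binomial_headS; lia.
Qed.

(** Pascal's rule applied four times expresses the left side by the heads of
    rows m to m + 3. Doubling at each row would give 16 times the head of row m,
    plus C(m, k + 1). Pascal's rule from row m to row m + 1 saves C(m, k) over
    doubling, and further doublings turn this into a total saving of 7 C(m, k),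
    whereas C(m, k + 1) <= 4 C(m, k). *)
Lemma binomial_head_step m k : m <= 4 * k.+1 ->
  binomial_head m.+4 k.+2 <= 16 * binomial_head m k.+1.
Proof.
move=> mk.
have c4 : 'C(m, k.+1) <= 4 * 'C(m, k).
  rewrite -(@leq_pmul2l k.+1)// mul_bin_left mulnCA mulnA leq_mul2r.
  by apply/orP; right; lia.
have h1 := binomial_head_pascal m k.
have h2 := binomial_head_double m.+1 k.+1.
have h3 := binomial_head_double m.+2 k.+1.
have := binomial_headS m k; have := binomial_headS m k.+1.
by rewrite !binomial_head_pascal in h1 h2 h3 *; lia.
Qed.

(** A step from m to m + 4 multiplies the right side by 16 and the left side by at
    most 16, by binomial_head_step, so that rows 3 to 6 are enough. *)
Lemma binomial_head_lt m : 3 <= m ->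
  binomial_head m ((m - 1) %/ 4).+1 < 2 ^ (m - 2).
Proof.
have [k] := ubnP m; elim: k m => // k IH m mk m3.
have [m7|m7] := ltnP m 7.
  by case: m m3 m7 {mk} => [|[|[|[|[|[|[|m]]]]]]] // _ _; rewrite /binomial_head unlock.
have -> : m = (m - 4).+4 by lia.
have := IH (m - 4) ltac:(lia) ltac:(lia).
set q := m - 4 => h.
have -> : (q.+4 - 1) %/ 4 = ((q - 1) %/ 4).+1 by lia.
have -> : q.+4 - 2 = (q - 2) + 4 by lia.
rewrite expnD; have := @binomial_head_step q ((q - 1) %/ 4) ltac:(lia).
by move: h; set u := binomial_head _ _; set v := binomial_head _ _; set w := 2 ^ _; lia.
Qed.

(** In the expansion of (3 + 1)^m the terms of index at most k carry a factor at
    least 3^(m - k), so that 3^(m - k) times the head is at most 4^m. Take fourth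
    powers and use 4 (m - k) >= 3 m. *)
Lemma binomial_head_expn m k : 4 * k <= m ->
  27 ^ m * binomial_head m k.+1 ^ 4 <= 256 ^ m.
Proof.
move=> km; have k_m : k <= m by lia.
have h : 3 ^ (m - k) * binomial_head m k.+1 <= 4 ^ m.
  rewrite (_ : 4 = 3 + 1)// expnDn.
  rewrite -(big_mkord xpredT (fun i => 'C(m, i) * (3 ^ (m - i) * 1 ^ i))).
  rewrite (big_cat_nat (n := k.+1))//= -[leqLHS]addn0 leq_add//.
  rewrite /binomial_head big_distrr /= big_nat [leqRHS]big_nat.
  apply: leq_sum => i /andP[_ ik].
  by rewrite exp1n muln1 mulnC leq_mul2l leq_exp2l// leq_sub2l ?orbT// -ltnS.
rewrite (_ : 256 = 4 ^ 4)// -expnM [X in 4 ^ X]mulnC expnM.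
apply: leq_trans (_ : (3 ^ (m - k) * binomial_head m k.+1) ^ 4 <= _); last first.
  by rewrite leq_exp2r.
rewrite expnMn leq_mul2r (_ : 27 = 3 ^ 3)// -!expnM leq_exp2l//.
by apply/orP; right; lia.
Qed.

Local Open Scope ring_scope.

Lemma card_draws_le (T : finType) K :
  #|[set A : {set T} | (#|A| <= K)%N]%SET| = binomial_head #|T| K.+1.
Proof.
elim: K => [|K IH].
  rewrite /binomial_head big_nat1 -card_draws; apply: eq_card => A.
  by rewrite !inE leqn0.
rewrite binomial_headS -IH -card_draws -(cardsID [set A : {set T} | #|A| == K.+1]%SET) addnC.
by congr (_ + _)%N; apply: eq_card => A; rewrite !inE; case: ltngtP; lia.
Qed.

(** The two families of patterns are exchanged by complementation, and they are
    disjoint because 2K < m. *)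
Lemma card_skewed_patterns m K : (K.*2 < m)%N ->
  #|skewed_patterns (m := m) K| = (4 * binomial_head m K.+1)%N.
Proof.
move=> Km; pose L := [set A : {set 'I_m} | (#|A| <= K)%N]%SET.
have cL : #|L| = binomial_head m K.+1 by rewrite card_draws_le card_ord.
have -> : skewed_patterns (m := m) K = finset.setX [set: bool]%SET (L :|: [set ~: A | A in L]%SET).
  apply/finset.setP => -[s A]; rewrite !inE /=; congr (_ || _).
  apply/idP/imsetP => [AK|[C]]; last by rewrite inE => CK ->; rewrite finset.setCK.
  by exists (~: A); rewrite ?inE// finset.setCK.
rewrite cardsX cardsT card_bool cardsU card_imset; last exact: finset.setC_inj.
rewrite (_ : L :&: _ = finset.set0) ?cards0 ?cL; first lia.
apply/finset.setP => A; rewrite !inE; apply/negP => /andP[AK /imsetP[C]].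
rewrite inE => CK AE; have := cardsC C; rewrite -AE card_ord; lia.
Qed.

(** The exponent gains 1 to absorb the factor 4, as 4 <= 256/27. *)
Lemma powR_binomial_head (R : realType) n m k : (4 * k <= m)%N -> (m <= n)%N ->
  (4 * binomial_head m k.+1)%N%:R <= (256 / 27) `^ (n%:R / 4 + 1) :> R.
Proof.
move=> km mn; set S := binomial_head m k.+1.
have a1 : 1 <= 256 / 27 :> R by lra.
have S4 : S%:R ^+ 4 <= (256 / 27) ^+ n :> R.
  apply: (@le_trans _ _ ((256 / 27) ^+ m)); last exact: ler_weXn2l.
  rewrite expr_div_n ler_pdivlMr ?exprn_gt0// mulrC -!natrX -natrM ler_nat.
  exact: binomial_head_expn.
rewrite powRD; last by apply/implyP => _; rewrite gt_eqF//; lra.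
rewrite powRr1; last by lra.
rewrite natrM mulrC; apply: ler_pM => //; last by lra.
rewrite -(@ler_pXn2r _ 4)// ?nnegrE ?powR_ge0// -[leRHS]powR_mulrn ?powR_ge0//.
by rewrite -powRrM divfK ?pnatr_eq0// powR_mulrn//; lra.
Qed.

(** * The illumination theorem *)

Lemma m_double_le (R : realType) n (B : set 'rV[R]_n) :
  (m_ B)%:R <= n%:R / 2 :> R -> ((m_ B).*2 <= n)%N.
Proof.
by rewrite ler_pdivlMr ?ltr0n// -natrM ler_nat muln2.
Qed.

Lemma one_bigO_ln (R : realType) :
  ((fun=> 1) : nat -> R^o) =O_\oo (fun n : nat => ln (n%:R : R) : R^o).
Proof.
have l2 : 0 < ln (2 : R) by rewrite ln_gt0// ltr1n.
apply/eqO_exP; exists (ln 2)^-1; first by rewrite /= invr_gt0.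
near=> n; have n2 : (2 <= n)%N by near: n; exact: nbhs_infty_ge.
have ln2n : ln (2 : R) <= ln n%:R.
  by rewrite ler_ln ?posrE ?ler_nat// ltr0n (leq_trans _ n2).
rewrite /= normr1 ler_pdivlMl// mulr1 ger0_norm//.
by rewrite (le_trans _ ln2n)// ltW.
Unshelve. all: by end_near. Qed.

Theorem theorem21 (R : realType) :
  (forall n : nat, (4 <= n)%N ->
     let N := (4 * \sum_(0 <= s < ((n - 2) %/ 4).+1) 'C(n.-1, s))%N in
     (exists T : set 'rV[R]_n,
        [/\ T `<=` G_ n (n.+1%:R^-1),
            T #= `I_N,
            (N <= 2 ^ n.-1 - 4)%N
          & forall B : set 'rV[R]_n, class_S B -> (m_ B)%:R <= n%:R / 2 :> R ->
            forall I : set 'rV[R]_n.-1,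
              I `<=` G_ n.-1 (n%:R^-1) ->
              I #= `I_(2 ^ n.-1) ->
              (forall x : 'rV[R]_n.-1, x != 0 -> deep_illuminates I x) ->
              illuminates ([set append0 x | x in I] `|` T) B]) /\
     (forall B : set 'rV[R]_n, class_S B -> (m_ B)%:R <= n%:R / 2 :> R ->
        (illumination_number B <= (2 ^ n - 4)%N%:R%:E)%E)) /\
  (exists2 g : nat -> R,
     (g : nat -> R^o) =O_\oo (fun n : nat => ln (n%:R : R) : R^o) &
     \forall n \near \oo,
       forall B : set 'rV[R]_n, class_S B -> (m_ B)%:R <= n%:R / 2 :> R ->
         (illumination_number B <=
           (2 ^+ n.-1 + (256 / 27) `^ (n%:R / 4 + g n))%:E)%E).
Proof.
pose K n := ((n - 2) %/ 4)%N.
have main m : (3 <= m)%N ->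
    let T := (uncurry (peaked_dir (m.+2%:R^-1 : R))) @`
      [set` skewed_patterns (m := m) (K m.+1)] in
    [/\ T `<=` G_ m.+1 m.+2%:R^-1,
        T #= `I_(4 * \sum_(0 <= s < (K m.+1).+1) 'C(m, s))
      & forall B : set 'rV[R]_m.+1, class_S B -> (m_ B)%:R <= m.+1%:R / 2 :> R ->
          forall I : set 'rV[R]_m, I `<=` G_ m (m.+1%:R^-1) ->
            (forall x : 'rV[R]_m, x != 0 -> deep_illuminates I x) ->
            illuminates ([set append0 (n := m.+1) x | x in I] `|` T) B].
  move=> m3 T; split=> [_ [[s A] _ <-]||B SB mB I IG Ideep].
  - exact: peaked_dir_G.
  - rewrite -/(binomial_head _ _) -card_skewed_patterns; last by rewrite /K; lia.
    by apply: image_finset_card; exact: peaked_dir_inj.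
  - apply: (illuminates_all (delta := m.+1%:R^-1)) => //.
    (* With K the integer part of (m - 1) / 4, (m + 1) / 2 is less than 2K + 3. *)
    + by have := m_double_le mB; rewrite /K; lia.
    + by rewrite ltr_pdivrMr// mul1r ltr_nat.
    + by rewrite ltr_pdivrMr// mul1r ltr_nat; lia.
have head_le m : (3 <= m)%N ->
    (4 * \sum_(0 <= s < (K m.+1).+1) 'C(m, s) <= 2 ^ m - 4)%N.
  move=> m3; have := binomial_head_lt m3.
  rewrite /binomial_head (_ : (m - 1)%N = (m.+1 - 2)%N); last lia.
  rewrite -/(K m.+1) (_ : 2 ^ m = 4 * 2 ^ (m - 2))%N; first lia.
  by rewrite -[4%N]/(2 ^ 2)%N -expnD; congr (_ ^ _)%N; lia.
have number m (B : set 'rV[R]_m.+1) : (3 <= m)%N -> class_S B ->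
    (m_ B)%:R <= m.+1%:R / 2 :> R ->
    (illumination_number B <=
      (2 ^ m + 4 * \sum_(0 <= s < (K m.+1).+1) 'C(m, s))%N%:R%:E)%E.
  case: m B => // m B m3 SB mB; have [_ Tcard Till] := main _ m3.
  pose I : set 'rV[R]_m.+1 := range (run_dir m.+2%:R^-1).
  have IG : I `<=` G_ m.+1 m.+2%:R^-1 by move=> _ [A _ <-]; exact: run_dir_G.
  have Icard : [set append0 (n := m.+2) x | x in I] #= `I_(2 ^ m.+1).
    have injA : injective (@append0 R m.+2).
      move=> u v /rowP uv; apply/rowP => k.
      by have := uv (lift ord_max k); rewrite !append0_lift.
    rewrite (card_eql (inj_card_eq (in2W injA))).
    have := @image_finset_card _ _ (run_dir (m.+2%:R^-1 : R)) [set: {set 'I_m.+1}]%SET.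
    have -> : #|[set: {set 'I_m.+1}]%SET| = (2 ^ m.+1)%N.
      by rewrite -powersetT card_powerset cardsT card_ord.
    rewrite (_ : [set` _] = setT); last first.
      by apply/seteqP; split => // A _; rewrite /= inE.
    by apply; exact: run_dir_inj.
  have Ideep (x : 'rV[R]_m.+1) : x != 0 -> deep_illuminates I x.
    by move=> x0; apply: run_dir_deep.
  exact: (illumination_number_leU Icard Tcard (Till B SB mB I IG Ideep)).
split; [case=> [//|m] m3 N; split|].
- have [TG Tcard Till] := main _ m3.
  exists ((uncurry (peaked_dir (m.+2%:R^-1 : R))) @`
      [set` skewed_patterns (m := m) (K m.+1)]); split => //.
    exact: head_le.
  by move=> B SB mB I IG _; exact: Till.
- move=> B SB mB; apply: le_trans (number _ _ m3 SB mB) _.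
  rewrite lee_fin ler_nat expnS; have := head_le _ m3.
  have : (2 ^ 2 <= 2 ^ m)%N by rewrite leq_exp2l//; lia.
  by lia.
exists (fun=> 1); first exact: one_bigO_ln.
exists 4%N => // -[|m] //= m3 B SB mB.
apply: le_trans (number _ _ m3 SB mB) _.
rewrite lee_fin natrD natrX lerD2l; apply: powR_binomial_head => //.
by rewrite /K; lia.
Qed.
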